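(* Let $A\in\mathbb{R}^{m\times n}$, $b\in\mathbb{R}^m$, let $f:\mathbb{R}^n\to\mathbb{R}$ be a closed convex function, and let $g:\mathbb{R}^n\to\mathbb{R}$ be a convex smooth function whose gradient is Lipschitz continuous with constant $L_g>0$, i.e. $\|\nabla g(x)-\nabla g(y)\|\le L_g\|x-y\|$ for all $x,y\in\mathbb{R}^n$. Suppose the KKT set $\Omega$ of the problem $\min_x f(x)+g(x)$ s.t. $Ax=b$ is nonempty and let $(x^*,\lambda^* )\in\Omega$. Let $\{(x_k,\lambda_k)\}_{k\ge1}$ be a sequence generated by Algorithm 2 (described in the context) with parameters $s>0$, $\alpha\ge3$, with matrices satisfying $M_{k-1}\succcurlyeq M_k\succcurlyeq sL_g\,Id$ for all $k\ge1$, and with errors satisfying $$\sum_{k=1}^{+\infty}k\|\epsilon_k\|<+\infty .$$ Put $\mathcal{E}_1=\frac12\|x_1-x^*\|_{M_0}^2+\frac12\|\lambda_1-\lambda^*\|^2$ and $$C=\frac12\|x_1-x^*\|_{M_0}^2+\frac12\|\lambda_1-\lambda^*\|^2+\frac{s}{\alpha-1}\left(\sqrt{\frac{2\mathcal{E}_1}{sL_g}}+\frac{2}{(\alpha-1)L_g}\sum_{j=1}^{+\infty}j\|\epsilon_j\|\right)\times\sum_{j=1}^{+\infty}j\|\epsilon_j\| .$$ Then for all $k>1$, $$\|Ax_k-b\|\le\frac{4(\alpha-1)^2\sqrt{2C}}{s(k-1)(k+\alpha-3)},$$ $$|f(x_k)+g(x_k)-f(x^* )-g(x^* )|\le\frac{(\alpha-1)^2C}{s(k^2-k)}+\frac{4(\alpha-1)^2\sqrt{2C}\,\|\lambda^*\|}{s(k-1)(k+\alpha-3)}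 .$$
   Context: Notation: $\|\cdot\|$ is the Euclidean norm and $Id$ the identity matrix. $\mathbb{S}_+(n)$ is the set of (symmetric) positive semidefinite $n\times n$ real matrices; for $M\in\mathbb{S}_+(n)$, $\|x\|_M=\sqrt{x^TMx}$; $M_1\succcurlyeq M_2$ means $\|x\|_{M_1}\ge\|x\|_{M_2}$ for all $x\in\mathbb{R}^n$. $\partial$ denotes the convex subdifferential. KKT set: with $F=f+g$, $\Omega$ is the set of $(x^*,\lambda^* )\in\mathbb{R}^n\times\mathbb{R}^m$ with $-A^T\lambda^*\in\partial F(x^* )$ and $Ax^*-b=0$. Algorithm 2. Initialization: choose $x_0\in\mathbb{R}^n$, $\lambda_0\in\mathbb{R}^m$, set $x_1=x_0$, $\lambda_1=\lambda_0$, $\epsilon_0=0$, choose $M_0\in\mathbb{S}_+(n)$ and parameters $s>0$, $\alpha\ge3$. For $k=1,2,\dots$: Step 1: $\bar x_k=x_k+\frac{k-2}{k+\alpha-2}(x_k-x_{k-1})$, $\bar\lambda_k=\lambda_k+\frac{k-2}{k+\alpha-2}(\lambda_k-\lambda_{k-1})$. Step 2: set $\hat\lambda_k=\frac{k+\alpha-2}{\alpha-1}\bar\lambda_k-\frac{k-1}{\alpha-1}\lambda_k$ and $\eta_k=\frac{k-1}{k+\alpha-2}Ax_k+\frac{\alpha-1}{k+\alpha-2}b$; choose $M_k\in\mathbb{S}_+(n)$, $\epsilon_k\in\mathbb{R}^n$ and take $$x_{k+1}\in\arg\min_x\ f(x)+\frac{k+\alpha-2}{2sk}\|x-\bar x_k\|_{M_k}^2+\frac{sk(k+\alpha-2)}{2(\alpha-1)^2}\|Ax-\eta_k\|^2+\langle\nabla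 g(\bar x_k)+A^T\hat\lambda_k-\epsilon_k,x\rangle .$$ Step 3: $\lambda_{k+1}=\bar\lambda_k+\frac{sk}{k+\alpha-2}\left(Ax_{k+1}-b+\frac{k-1}{\alpha-1}A(x_{k+1}-x_k)\right)$. ''A sequence generated by Algorithm 2'' means any infinite sequence satisfying these relations for all $k\ge1$ (no stopping condition is applied). *)

(* Defs.v *)
From HB Require Import structures.
From mathcomp Require Import all_boot all_order all_algebra.
From mathcomp Require Import all_classical all_reals all_analysis.

Set Implicit Arguments.
Unset Strict Implicit.
Unset Printing Implicit Defensive.

Import Order.TTheory GRing.Theory Num.Theory.
Import numFieldNormedType.Exports.

Local Open Scope classical_set_scope.
Local Open Scope ring_scope.

Section Euclidean.
Variables (R : realType) (n : nat).
Implicit Types (x y v : 'cV[R]_n) (M : 'M[R]_n).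

Definition dotp x y : R := (x^T *m y) 0 0.

(* The library norm [`|x|] on matrices is the sup norm, not this one. *)
Definition norm2 x : R := Num.sqrt (dotp x x).

Definition possemidef M : Prop := M^T = M /\ forall x, 0 <= dotp x (M *m x).

Definition normM M x : R := Num.sqrt (dotp x (M *m x)).

Definition mx_succeq M1 M2 : Prop := forall x, normM M2 x <= normM M1 x.

(* Closedness (lower semicontinuity) in the sense of convex analysis. *)
Definition closed_function (f : 'cV[R]_n -> R) : Prop :=
  closed [set p : 'cV[R]_n * R^o | f p.1 <= p.2].

Definition subdiff (F : 'cV[R]_n -> R) x : set 'cV[R]_n :=
  [set v | forall y, F x + dotp v (y - x) <= F y].

Definition argmin (phi : 'cV[R]_n -> R) : set 'cV[R]_n :=
  [set x | forall y, phi x <= phi y].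

(* The vector of partial derivatives; it represents the differential of g at x
   where g is differentiable. *)
Definition gradient (g : 'cV[R]_n -> R) x : 'cV[R]_n :=
  \col_i 'D_(delta_mx i 0) (g : 'cV[R]_n -> R^o) x.

Definition smooth_with (L : R) (g : 'cV[R]_n -> R) : Prop :=
  (forall x, differentiable (g : 'cV[R]_n -> R^o) x) /\
  (forall x y, norm2 (gradient g x - gradient g y) <= L * norm2 (x - y)).

Definition weighted_error_sum (eps : nat -> 'cV[R]_n) : \bar R :=
  (\sum_(1 <= k <oo) (k%:R * norm2 (eps k))%:E)%E.

End Euclidean.

Definition KKT (R : realType) (m n : nat) (F : 'cV[R]_n -> R)
    (A : 'M[R]_(m, n)) (b : 'cV[R]_m) : set ('cV[R]_n * 'cV[R]_m) :=
  [set p | subdiff F p.1 (- (A^T *m p.2)) /\ A *m p.1 - b = 0].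

Section Algorithm.
Variables (R : realType) (m n : nat) (A : 'M[R]_(m, n)) (b : 'cV[R]_m).
Variables (f g : 'cV[R]_n -> R) (s alpha : R).

(* The coefficient k - 2 is a real subtraction: it is -1 at k = 1. *)
Definition extrapolate (d : nat) (u : nat -> 'cV[R]_d) (k : nat) : 'cV[R]_d :=
  u k + ((k%:R - 2) / (k%:R + alpha - 2)) *: (u k - u k.-1).

Definition lambda_hat (lam : nat -> 'cV[R]_m) (k : nat) : 'cV[R]_m :=
  ((k%:R + alpha - 2) / (alpha - 1)) *: extrapolate lam k
  - ((k%:R - 1) / (alpha - 1)) *: lam k.

Definition eta (x : nat -> 'cV[R]_n) (k : nat) : 'cV[R]_m :=
  ((k%:R - 1) / (k%:R + alpha - 2)) *: (A *m x k)
  + ((alpha - 1) / (k%:R + alpha - 2)) *: b.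

Definition subproblem (x : nat -> 'cV[R]_n) (lam : nat -> 'cV[R]_m)
    (Mk : 'M[R]_n) (epsk : 'cV[R]_n) (k : nat) (y : 'cV[R]_n) : R :=
  f y
  + (k%:R + alpha - 2) / (2 * s * k%:R)
      * normM Mk (y - extrapolate x k) ^+ 2
  + (s * k%:R * (k%:R + alpha - 2)) / (2 * (alpha - 1) ^+ 2)
      * norm2 (A *m y - eta x k) ^+ 2
  + dotp (gradient g (extrapolate x k) + A^T *m lambda_hat lam k - epsk) y.

Definition generated_by_algorithm (x : nat -> 'cV[R]_n)
    (lam : nat -> 'cV[R]_m) (M : nat -> 'M[R]_n) (eps : nat -> 'cV[R]_n)
    : Prop :=
  [/\ [/\ x 1%N = x 0%N, lam 1%N = lam 0%N & eps 0%N = 0],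
      forall k, possemidef (M k),
      forall k, (1 <= k)%N ->
        argmin (subproblem x lam (M k) (eps k) k) (x k.+1)
    & forall k, (1 <= k)%N ->
        lam k.+1 = extrapolate lam k
          + (s * k%:R / (k%:R + alpha - 2)) *:
              (A *m x k.+1 - b
               + ((k%:R - 1) / (alpha - 1)) *: (A *m (x k.+1 - x k)))].

End Algorithm.

(* Main.v *)
Require Import Defs.
From HB Require Import structures.
From mathcomp Require Import all_boot all_order all_algebra.
From mathcomp Require Import all_classical all_reals all_analysis.
From mathcomp Require Import ring lra.

Import Order.TTheory GRing.Theory Num.Theory.
Import numFieldNormedType.Exports.

Local Open Scope classical_set_scope.
Local Open Scope ring_scope.

(** Put [a = alpha - 1], [z_k = x_k + (k-2)/a (x_k - x_(k-1))] and define [mu_k]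
    from [lam] in the same way.  Optimality in the subproblem, combined with the
    quadratic upper bound on [g], bounds [lag (x_(k+1)) - lag y] for every [y],
    where [lag y = f y + g y - f xs - g xs + <ls, A y - b> >= 0].  Weighting
    [y = x_k] by [(k-1)/a] and [y = xs] by [1] gives the descent estimate
    [E_(k+1) <= E_k + (s/a) k <eps_k, z_(k+1) - xs>] for the energy
    [E_k = s k (k-1) / a^2 lag (x_k) + 1/2 |z_k - xs|^2_(M_(k-1)) + 1/2 |mu_k - ls|^2].
    A discrete Bihari inequality bounds [|z_k - xs|], hence [E_k <= C].  This
    controls [lag (x_k)] and [|mu_k - ls|].  Finally [w_k = (k-1)(k+alpha-3)(A x_k - b)]
    satisfies [w_(k+1) = t_k w_k + a^2/s (mu_(k+1) - mu_k)] with [0 <= t_k <= 1], so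
    [w_k - a^2/s (mu_k - ls)] stays bounded: its successor is a convex
    combination of itself and [- a^2/s (mu_k - ls)]. *)

(** * Euclidean inner product, then quadratic forms of positive semidefinite matrices *)

Section Dotp.
Context {R : realType} {n : nat}.
Implicit Types (x y z : 'cV[R]_n) (c : R).

Lemma dotpE x y : dotp x y = \sum_i x i 0 * y i 0.
Proof. by rewrite /dotp mxE; apply: eq_bigr => i _; rewrite mxE. Qed.

Lemma dotpC x y : dotp x y = dotp y x.
Proof. by rewrite !dotpE; apply: eq_bigr => i _; rewrite mulrC. Qed.

Lemma dotpDl x y z : dotp (x + y) z = dotp x z + dotp y z.
Proof. by rewrite /dotp linearD /= mulmxDl mxE. Qed.

Lemma dotpZl c x y : dotp (c *: x) y = c * dotp x y.
Proof. by rewrite /dotp linearZ /= -scalemxAl mxE. Qed.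

Lemma dotpNl x y : dotp (- x) y = - dotp x y.
Proof. by rewrite -scaleN1r dotpZl mulN1r. Qed.

Lemma dotpBl x y z : dotp (x - y) z = dotp x z - dotp y z.
Proof. by rewrite dotpDl dotpNl. Qed.

Lemma dotpDr x y z : dotp x (y + z) = dotp x y + dotp x z.
Proof. by rewrite dotpC dotpDl !(dotpC x). Qed.

Lemma dotpZr c x y : dotp x (c *: y) = c * dotp x y.
Proof. by rewrite dotpC dotpZl dotpC. Qed.

Lemma dotpNr x y : dotp x (- y) = - dotp x y.
Proof. by rewrite dotpC dotpNl dotpC. Qed.

Lemma dotpBr x y z : dotp x (y - z) = dotp x y - dotp x z.
Proof. by rewrite dotpDr dotpNr. Qed.

Definition dotp_bilin :=
  (dotpDl, dotpBl, dotpNl, dotpZl, dotpDr, dotpBr, dotpNr, dotpZr).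

Lemma dotp_ge0 x : 0 <= dotp x x.
Proof. by rewrite dotpE; apply: sumr_ge0 => i _; rewrite -expr2 sqr_ge0. Qed.

Lemma norm2_ge0 x : 0 <= norm2 x.
Proof. exact: sqrtr_ge0. Qed.

Lemma sqr_norm2 x : norm2 x ^+ 2 = dotp x x.
Proof. by rewrite sqr_sqrtr// dotp_ge0. Qed.

Lemma norm2_le x c : 0 <= c -> dotp x x <= c ^+ 2 -> norm2 x <= c.
Proof. by move=> c0; rewrite -sqr_norm2 ler_pXn2r// nnegrE norm2_ge0. Qed.

Lemma norm2Z c x : norm2 (c *: x) = `|c| * norm2 x.
Proof.
by rewrite /norm2 dotpZl dotpZr mulrA -expr2 sqrtrM ?sqr_ge0// sqrtr_sqr.
Qed.

Lemma norm2N x : norm2 (- x) = norm2 x.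
Proof. by rewrite -scaleN1r norm2Z normrN1 mul1r. Qed.

(** Cauchy-Schwarz: for [y] nonzero, expand the squared norm of [<y,y> x - <x,y> y], which is
    [<y,y> (<x,x><y,y> - <x,y>^2)]. *)
Lemma dotp_le_norm2 x y : dotp x y <= norm2 x * norm2 y.
Proof.
have [y0|y0] := eqVneq (dotp y y) 0.
  have y_eq0 : y = 0.
    apply/matrixP => i j; rewrite ord1 mxE.
    move: y0; rewrite dotpE => /eqP; rewrite psumr_eq0; last first.
      by move=> k _; rewrite -expr2 sqr_ge0.
    by move=> /allP/(_ i); rewrite mem_index_enum mulf_eq0 orbb => /(_ isT)/eqP.
  by rewrite y_eq0 -(scale0r 0) dotpZr mul0r mulr_ge0 ?norm2_ge0.
have ygt0 : 0 < dotp y y by rewrite lt_def y0 dotp_ge0.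
apply: (le_trans (ler_norm _)).
rewrite -ler_sqr ?nnegrE ?mulr_ge0 ?norm2_ge0// exprMn !sqr_norm2 real_normK ?num_real//.
have := dotp_ge0 (dotp y y *: x - dotp x y *: y).
rewrite !dotp_bilin (dotpC y x).
rewrite (_ : _ - _ = dotp y y * (dotp x x * dotp y y - dotp x y ^+ 2)); last by ring.
by rewrite pmulr_rge0// subr_ge0.
Qed.

Lemma normr_dotp_le_norm2 x y : `|dotp x y| <= norm2 x * norm2 y.
Proof.
by rewrite ler_norml dotp_le_norm2 lerNl -dotpNl -(norm2N x) dotp_le_norm2.
Qed.

Lemma norm2D x y : norm2 (x + y) <= norm2 x + norm2 y.
Proof.
apply: norm2_le; first by rewrite addr_ge0 ?norm2_ge0.
rewrite sqrrD !sqr_norm2 !dotp_bilin (dotpC y x).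
have := dotp_le_norm2 x y; lra.
Qed.

End Dotp.

Lemma dotp_mulmx {R : realType} {m n} (A : 'M[R]_(m, n)) x y :
  dotp x (A *m y) = dotp (A^T *m x) y.
Proof. by rewrite /dotp trmx_mul trmxK mulmxA. Qed.

Section NormM.
Context {R : realType} {n : nat}.
Implicit Types (M : 'M[R]_n) (x y z : 'cV[R]_n).

Lemma sqr_normM M x : possemidef M -> normM M x ^+ 2 = dotp x (M *m x).
Proof. by case=> _ /(_ x) M0; rewrite sqr_sqrtr. Qed.

Lemma dotp_mulmx_sym M x y : possemidef M ->
  dotp x (M *m y) = dotp y (M *m x).
Proof. by case=> Msym _; rewrite dotp_mulmx Msym dotpC. Qed.

Lemma possemidef_scalar (c : R) : 0 <= c -> possemidef (c%:M : 'M[R]_n).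
Proof.
move=> c0; split; first by rewrite tr_scalar_mx.
by move=> x; rewrite mul_scalar_mx dotpZr mulr_ge0// dotp_ge0.
Qed.

Lemma mx_succeq_dotp M N x : possemidef M -> possemidef N ->
  mx_succeq M N -> dotp x (N *m x) <= dotp x (M *m x).
Proof.
move=> Mpos Npos /(_ x).
by rewrite -!sqr_normM// -ler_sqr ?nnegrE ?sqrtr_ge0.
Qed.

End NormM.

(** * Convexity and smoothness *)

Section Convex.
Context {R : realType} {n : nat}.
Implicit Types (f g : 'cV[R]_n -> R) (x y : 'cV[R]_n).

(** Dividing by [t] and letting [t] tend to 0 would give the claim. It replaces the limit in every
    first-order condition below. *)
Lemma ler_linear_quadratic (a b : R) :
  (forall t, 0 < t <= 1 -> 0 <= t * a + t ^+ 2 * b) -> 0 <= a.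
Proof.
move=> h; rewrite leNgt; apply/negP => a0.
have b1 : 0 < `|b| + 1 by rewrite ltr_wpDl.
(* If [a < 0], this [t] gives [t |b| <= - a / 2], so [a + t b] is still negative. *)
have t0 : 0 < Num.min 1 (- a / (`|b| + 1) / 2).
  by rewrite lt_min ltr01 !divr_gt0// oppr_gt0.
set t := Num.min _ _ in t0.
have t1 : t <= 1 by rewrite ge_min lexx.
have : t <= - a / (`|b| + 1) / 2 by rewrite ge_min lexx orbT.
rewrite -mulrA -invfM ler_pdivlMr ?mulr_gt0// => ta.
have := h t; rewrite t0 t1 => /(_ isT).
rewrite (_ : _ + _ = t * (a + t * b)); last by ring.
rewrite pmulr_rge0//.
have : t * b <= t * `|b| by rewrite ler_pM2l// ler_norm.
by lra.
Qed.

Lemma convex_functionP f x y (t : R) : convex_function [set: 'cV[R]_n] f ->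
  0 <= t <= 1 -> f (x + t *: (y - x)) <= f x + t * (f y - f x).
Proof.
move=> cf /andP[t0 t1].
pose t' : {i01 R} := Itv01 t0 t1.
have := cf t' y x; rewrite !inE => /(_ I I).
rewrite convRE /conv/= /unstable.onem.
have -> : t *: y + (1 - t) *: x = x + t *: (y - x).
  by apply/matrixP => i j; rewrite !mxE; ring.
by move=> /le_trans; apply; rewrite le_eqVlt; apply/orP; left; apply/eqP; ring.
Qed.

(** Applied to [t (y - x)], the quadratic error is of order [t^2] while convexity is linear in [t],
    so the error disappears at first order. *)
Lemma convex_gradient_le g x y v (L : R) :
  convex_function [set: 'cV[R]_n] g ->
  (forall d, g x + dotp v d - L / 2 * dotp d d <= g (x + d)) ->
  g x + dotp v (y - x) <= g y.
Proof.
move=> cg gv; rewrite -subr_ge0.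
apply: (ler_linear_quadratic _ (L / 2 * dotp (y - x) (y - x))) => t /andP[t0 t1].
have := gv (t *: (y - x)); rewrite !dotp_bilin.
have := @convex_functionP g x y t cg; rewrite (ltW t0) t1 => /(_ isT).
by lra.
Qed.

End Convex.

Section Gradient.
Context {R : realType} {n : nat}.
Implicit Types (g : 'cV[R]_n -> R) (x d : 'cV[R]_n).

Lemma derive_gradient g x d : differentiable (g : 'cV[R]_n -> R^o) x ->
  'D_d (g : 'cV[R]_n -> R^o) x = dotp (gradient g x) d.
Proof.
move=> dg; rewrite deriveE// dotpE.
have -> : d = \sum_i d i 0 *: delta_mx i 0 :> 'cV[R]_n.
  rewrite {1}(matrix_sum_delta d); apply: eq_bigr => i _.
  by rewrite big_ord1.
rewrite linear_sum; apply: eq_bigr => i _; rewrite linearZ/= mxE deriveE// mulrC.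
congr (_ * _); rewrite summxE (bigD1 i)//= big1 ?addr0 => [|j ji]; rewrite !mxE.
  by rewrite !eqxx mulr1.
by rewrite eq_sym (negbTE ji) mulr0.
Qed.

(** The difference quotient of the restriction to the line is that of [g] at [x + t d] in direction
    [d], so nothing but a rewriting is needed. *)
Lemma is_derive_line g x d (t : R) :
  (forall x, differentiable (g : 'cV[R]_n -> R^o) x) ->
  is_derive t 1 (fun t : R => g (x + t *: d) : R^o)
    (dotp (gradient g (x + t *: d)) d).
Proof.
move=> dg.
have E : (fun h : R => h^-1 *: (((fun t : R => g (x + t *: d) : R^o) \o
           shift t) (h *: 1) - g (x + t *: d))) =
         (fun h : R => h^-1 *: (((g : 'cV[R]_n -> R^o) \o shift (x + t *: d))
           (h *: d) - g (x + t *: d))).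
  apply/funext => h /=; congr (_ *: (g _ - _)).
  by apply/matrixP => i j; rewrite !mxE [h *: 1]mulr1; ring.
have dg' := @diff_derivable _ _ _ _ _ d (dg (x + t *: d)).
split; first by rewrite /derivable E.
by rewrite /derive E -derive_gradient.
Qed.

(** The upper half is the descent lemma for [g]; the lower half feeds [convex_gradient_le] and so
    yields the gradient inequality. *)
Lemma smooth_taylor_le g x d (L : R) : smooth_with L g ->
  `|g (x + d) - g x - dotp (gradient g x) d| <= L / 2 * dotp d d.
Proof.
move=> [dg lipg].
(* [h c] is nonincreasing on [0, 1] for [c = 1] and for [c = -1]. *)
pose h (c t : R) : R^o :=
  c * (g (x + t *: d) - t * dotp (gradient g x) d) - L / 2 * t ^+ 2 * dotp d d.
pose dh (c t : R) : R := c * (dotp (gradient g (x + t *: d)) d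
  - dotp (gradient g x) d) - L * t * dotp d d.
have h_derive (c t : R) : is_derive t 1 (h c) (dh c t).
  have g_line := is_derive_line g x d t dg.
  have t_id := @is_derive_id R R t 1.
  have D := is_deriveB (is_deriveZ c (is_deriveB g_line
      (is_deriveZ (dotp (gradient g x) d) t_id)))
    (is_deriveZ (L / 2 * dotp d d) (is_deriveX 2 t_id)).
  set F := (_ - _) in D.
  have -> : h c = F.
    apply/funext => r.
    have -> : F r = c * (g (x + r *: d) - dotp (gradient g x) d * r)
                    - L / 2 * dotp d d * (r * r) by [].
    by rewrite /h; ring.
  apply: (is_derive_eq D).
  have E : c * (dotp (gradient g (x + t *: d)) d - dotp (gradient g x) d * 1)
      - L / 2 * dotp d d * (2 * t * 1) = dh c t by rewrite /dh; field.
  exact: E.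
have h_le c : `|c| = 1 -> h c 1 <= h c 0.
  move=> c1.
  have [|t t01 e] := @MVT R (h c) (dh c) 0 1 ltr01 (fun t _ => h_derive c t).
    apply: derivable_within_continuous => t _; exact: ex_derive.
  rewrite -subr_le0 e subr0 mulr1 /dh -dotpBl.
  move: t01; rewrite in_itv/= => /andP[t0 t1].
  (* The derivative is nonpositive by Cauchy-Schwarz and the Lipschitz bound between two points that
     differ by [t d]. *)
  rewrite subr_le0; apply: (le_trans (ler_norm _)).
  rewrite normrM c1 mul1r; apply: (le_trans (normr_dotp_le_norm2 _ _)).
  rewrite -sqr_norm2 expr2 mulrA ler_wpM2r ?norm2_ge0//.
  apply: (le_trans (lipg _ _)).
  by rewrite addrC addKr norm2Z (gtr0_norm t0) mulrA.
have h1 := h_le 1 (normr1 R).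
have hN1 := h_le (-1) (normrN1 R).
move: h1 hN1; rewrite /h !(scale1r, scale0r, addr0).
rewrite ler_norml; lra.
Qed.

End Gradient.

(** * Optimality condition of the subproblem *)

(** Fermat's rule for a convex function plus an exactly quadratic one: compare [x] with
    [x + t (y - x)]; the remainder [Q] is of second order in [t]. *)
Lemma argmin_subdiff {R : realType} {n : nat} (f phi q : 'cV[R]_n -> R)
    (x v : 'cV[R]_n) (Q : 'cV[R]_n -> R) :
  convex_function [set: 'cV[R]_n] f ->
  (forall y, phi y = f y + q y) ->
  (forall d t, q (x + t *: d) = q x + t * dotp v d + t ^+ 2 * Q d) ->
  argmin phi x -> subdiff f x (- v).
Proof.
move=> cf phiE qE xmin y; rewrite dotpNl -subr_ge0.
apply: (ler_linear_quadratic _ (Q (y - x))) => t /andP[t0 t1].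
have := xmin (x + t *: (y - x)); rewrite !phiE qE.
have := @convex_functionP _ _ f x y t cf; rewrite (ltW t0) t1 => /(_ isT).
by lra.
Qed.

Lemma subproblem_subdiff {R : realType} {m n : nat} (A : 'M[R]_(m, n)) b
    (f g : 'cV[R]_n -> R) (s alpha : R) (x : nat -> 'cV[R]_n) (lam : nat -> 'cV[R]_m)
    (M : 'M[R]_n) eps k (y : 'cV[R]_n) :
  convex_function [set: 'cV[R]_n] f -> possemidef M ->
  argmin (subproblem A b f g s alpha x lam M eps k) y ->
  subdiff f y (- ((2 * ((k%:R + alpha - 2) / (2 * s * k%:R)))
                    *: (M *m (y - extrapolate alpha x k))
                  + (2 * ((s * k%:R * (k%:R + alpha - 2)) / (2 * (alpha - 1) ^+ 2)))
                    *: (A^T *m (A *m y - Defs.eta A b alpha x k))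
                  + (gradient g (extrapolate alpha x k)
                     + A^T *m lambda_hat alpha lam k - eps))).
Proof.
move=> cf Mpos; rewrite /subproblem.
set c1 := _ / (2 * s * _); set c2 := _ / (2 * _ ^+ 2).
set xb := extrapolate alpha x k; set e := Defs.eta _ _ _ _ _.
set p := gradient _ _ + _ - _.
apply: (argmin_subdiff f _
  (fun y => c1 * normM M (y - xb) ^+ 2 + c2 * norm2 (A *m y - e) ^+ 2 + dotp p y)
  y _ (fun d => c1 * dotp d (M *m d) + c2 * dotp (A *m d) (A *m d))) => //.
  by move=> z; rewrite !addrA.
move=> d t; rewrite !sqr_normM// !sqr_norm2.
set u := y - xb; set w := A *m y - e.
have -> : y + t *: d - xb = u + t *: d by rewrite addrAC.
have -> : A *m (y + t *: d) - e = w + t *: (A *m d).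
  by rewrite mulmxDr -scalemxAr addrAC.
move: u w p => u w p; rewrite mulmxDr -scalemxAr !dotp_bilin -(dotp_mulmx A w).
rewrite (dotp_mulmx_sym M u d Mpos) (dotpC (M *m u)) (dotpC (A *m d) w).
by ring.
Qed.

(** * Inequalities for one energy step and for accumulated errors *)

Lemma dotp_polarization {R : realType} {n : nat} (M : 'M[R]_n) (u w : 'cV[R]_n) :
  possemidef M ->
  dotp (M *m (u - w)) u = 1 / 2 * dotp u (M *m u) - 1 / 2 * dotp w (M *m w)
                          + 1 / 2 * dotp (u - w) (M *m (u - w)).
Proof.
move=> Mpos; rewrite mulmxBr !dotp_bilin (dotp_mulmx_sym M w u Mpos).
by rewrite (dotpC (M *m u)) (dotpC (M *m w)); field.
Qed.

(** The sum contains [r k.+1] itself. If [r k.+1] exceeded [c + d S], it would dominate all earlier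
    terms, by induction, so [r^2 <= c^2 + d S r] with [r = r k.+1], impossible for [r > c + d S]. *)
Lemma discrete_bihari {R : realType} (r w : nat -> R) (c d S : R) :
  (forall k, 0 <= r k) -> (forall k, 0 <= w k) -> 0 <= c -> 0 <= d ->
  (forall k, \sum_(1 <= j < k) w j <= S) ->
  (forall k, (1 <= k)%N ->
     r k.+1 ^+ 2 <= c ^+ 2 + d * \sum_(1 <= j < k.+1) w j * r j.+1) ->
  forall k, (1 <= k)%N -> r k.+1 <= c + d * S.
Proof.
move=> r0 w0 c0 d0 wS rec; elim/ltn_ind => k IH k1.
rewrite leNgt; apply/negP => Br.
have S0 : 0 <= S by have := wS 0%N; rewrite big_geq.
have sum_le : \sum_(1 <= j < k.+1) w j * r j.+1 <= S * r k.+1.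
  apply: (@le_trans _ _ ((\sum_(1 <= j < k.+1) w j) * r k.+1)); last first.
    by rewrite ler_wpM2r.
  rewrite mulr_suml big_nat [leRHS]big_nat; apply: ler_sum => j /andP[j1 jk].
  rewrite ler_wpM2l//; move: jk; rewrite ltnS leq_eqVlt => /predU1P[->//|jk].
  by rewrite (le_trans (IH _ jk j1))// ltW.
have dS0 : 0 <= d * S by rewrite mulr_ge0.
have := rec k k1; have : d * \sum_(1 <= j < k.+1) w j * r j.+1 <= d * (S * r k.+1).
  by rewrite ler_wpM2l.
by nra.
Qed.

(* [N1], [N0], [Nd] stand for the squared [M_k]-norms of [z_(k+1) - xs],
   [z_k - xs], [z_(k+1) - z_k], and [N0'] for the second one in [M_(k-1)];
   [m1], [m0], [md] are the analogues for [mu]; [p1], [p0] are the values of the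
   subgradient on [x_(k+1) - x_k] and [x_(k+1) - xs]. *)
Lemma energy_step_scalar {R : realFieldType}
    {k al s L lag1 lag0 V N1 N0 N0' Nd m1 m0 md dd D p1 p0 : R} :
  1 <= k -> 3 <= al -> 0 < s -> 0 <= L -> 0 <= lag1 -> 0 <= D ->
  dd = ((k + al - 2) / (al - 1)) ^+ 2 * D -> s * L * dd <= Nd ->
  N0 <= N0' -> 0 <= md ->
  lag1 - lag0 <= p1 + L / 2 * D -> lag1 <= p0 + L / 2 * D ->
  (k - 1) / (al - 1) * p1 + p0
    = V - (al - 1) / (s * k) * (1 / 2 * N1 - 1 / 2 * N0 + 1 / 2 * Nd
                                + (1 / 2 * m1 - 1 / 2 * m0 + 1 / 2 * md)) ->
  s * (k + 1) * (k + 1 - 1) / (al - 1) ^+ 2 * lag1 + 1 / 2 * N1 + 1 / 2 * m1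
    <= s * k * (k - 1) / (al - 1) ^+ 2 * lag0 + 1 / 2 * N0' + 1 / 2 * m0
       + s / (al - 1) * (k * V).
Proof.
move=> k1 a3 s0 L0 lag1_ge0 D0 -> + N00 md0.
set Y := _ + (_ - _ + _) => Ndd.
have k0 : 0 < k by lra.
have a1 : 0 < al - 1 by lra.
have nz : (k != 0) * (s != 0) * (al - 1 != 0) by rewrite !gt_eqF.
have T0 : 0 <= s * k / (al - 1) by rewrite divr_ge0 ?mulr_ge0// ltW.
have e0 : 0 <= (k - 1) / (al - 1) by rewrite divr_ge0; lra.
(* The first inequality is weighted by [(k - 1) / (al - 1)] and added to the second; the total is
   then scaled by [s k / (al - 1)]. *)
move=> /(ler_wpM2l e0) step1 /(lerD step1).
rewrite (_ : _ + lag1 = ((k - 1) / (al - 1) + 1) * lag1 - (k - 1) / (al - 1) * lag0);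
  last by ring.
rewrite (_ : _ + (p0 + _) = (k - 1) / (al - 1) * p1 + p0
  + ((k - 1) / (al - 1) + 1) * (L / 2 * D)); last by ring.
move=> step pE; move: step; rewrite pE => /(ler_wpM2l T0).
set lhs := _ * (_ - _); set rhs := _ * (_ + _).
have -> : lhs = s * k * (k + al - 2) / (al - 1) ^+ 2 * lag1
               - s * k * (k - 1) / (al - 1) ^+ 2 * lag0.
  by rewrite /lhs; field; rewrite nz.
have -> : rhs = s / (al - 1) * (k * V) - Y
               + s * k * (k + al - 2) / (al - 1) ^+ 2 * (L / 2 * D).
  by rewrite /rhs; field; rewrite !nz.
(* [al >= 3] enters as [k + 1 <= k + al - 2]. *)
have coef_lag : s * (k + 1) * (k + 1 - 1) / (al - 1) ^+ 2 * lag1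
    <= s * k * (k + al - 2) / (al - 1) ^+ 2 * lag1.
  rewrite ler_wpM2r// ler_wpM2r ?invr_ge0 ?sqr_ge0//.
  rewrite addrK -!mulrA ler_pM2l// mulrC ler_pM2l//; lra.
(* The smoothness error is absorbed by the squared step [Nd], through [s L dd <= Nd]. *)
have coef_D : s * k * (k + al - 2) / (al - 1) ^+ 2 * (L / 2 * D)
    <= 1 / 2 * (s * L * (((k + al - 2) / (al - 1)) ^+ 2 * D)).
  rewrite -subr_ge0.
  rewrite (_ : _ - _ = s * (L * D) * (k + al - 2) * (al - 2)
                       / (2 * (al - 1) ^+ 2)); last by field; rewrite nz.
  have LD0 : 0 <= L * D by rewrite mulr_ge0.
  by rewrite divr_ge0 ?mulr_ge0 ?sqr_ge0//; lra.
move: coef_lag coef_D Ndd; rewrite /Y; lra.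
Qed.

(** * Energy estimate along the iterates *)

Section Iteration.
Context {R : realType} {m n : nat}.
Variables (A : 'M[R]_(m, n)) (b : 'cV[R]_m) (f g : 'cV[R]_n -> R).
Variables (Lg s alpha : R) (xs : 'cV[R]_n) (ls : 'cV[R]_m).
Variables (x : nat -> 'cV[R]_n) (lam : nat -> 'cV[R]_m).
Variables (M : nat -> 'M[R]_n) (eps : nat -> 'cV[R]_n).
Hypothesis f_convex : convex_function [set: 'cV[R]_n] f.
Hypothesis g_convex : convex_function [set: 'cV[R]_n] g.
Hypothesis Lg_gt0 : 0 < Lg.
Hypothesis g_smooth : smooth_with Lg g.
Hypothesis KKT_sol : KKT (fun z => f z + g z) A b (xs, ls).
Hypothesis s_gt0 : 0 < s.
Hypothesis alpha_ge3 : 3 <= alpha.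
Hypothesis alg : generated_by_algorithm A b f g s alpha x lam M eps.
Hypothesis M_decr : forall k, (1 <= k)%N -> mx_succeq (M k.-1) (M k).
Hypothesis M_lower : forall k, (1 <= k)%N -> mx_succeq (M k) ((s * Lg)%:M).

Definition leading {d} (u : nat -> 'cV[R]_d) k :=
  u k + ((k%:R - 2) / (alpha - 1)) *: (u k - u k.-1).

Let z k := leading x k.
Let mu k := leading lam k.

Lemma alpha1_gt0 : 0 < alpha - 1. Proof. by have := alpha_ge3; lra. Qed.

Lemma index_ge1 k : (1 <= k)%N -> 1 <= k%:R :> R.
Proof. by rewrite ler1n. Qed.

Lemma denom_neq0 k : (1 <= k)%N ->
  (k%:R != 0 :> R) * (k%:R + alpha - 2 != 0) * (alpha - 1 != 0) * (s != 0).
Proof.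
move=> k1; have := index_ge1 _ k1; have := alpha_ge3; have := s_gt0 => *.
by repeat split; apply/negP => /eqP; lra.
Qed.

Lemma leadingS {d} (u : nat -> 'cV[R]_d) k :
  leading u k.+1 = u k.+1 + ((k%:R - 1) / (alpha - 1)) *: (u k.+1 - u k).
Proof. by rewrite /leading /= -natr1 (_ : _ - 2 = k%:R - 1)//; ring. Qed.

Lemma leading_step {d} (u : nat -> 'cV[R]_d) k : (1 <= k)%N ->
  leading u k.+1 - leading u k
  = ((k%:R + alpha - 2) / (alpha - 1)) *: (u k.+1 - extrapolate alpha u k).
Proof.
move=> k1; rewrite leadingS /leading /extrapolate.
apply/matrixP => i j; rewrite !mxE; field.
by rewrite !(denom_neq0 _ k1).
Qed.

Lemma lambda_hatE k : (1 <= k)%N -> lambda_hat alpha lam k = mu k.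
Proof.
move=> k1; rewrite /lambda_hat /mu /leading /extrapolate.
apply/matrixP => i j; rewrite !mxE; field.
by rewrite !(denom_neq0 _ k1).
Qed.

(** In the variables [z] and [mu] the multiplier update is a plain dual ascent step with the
    residual taken at [z k.+1]. *)
Lemma mu_step k : (1 <= k)%N ->
  mu k.+1 - mu k = (s * k%:R / (alpha - 1)) *: (A *m z k.+1 - b).
Proof.
move=> k1; rewrite leading_step//; have [_ _ _ /(_ _ k1) ->] := alg.
rewrite (addrC (extrapolate _ _ _)) addrK scalerA /z leadingS.
rewrite (mulmxDr A _ (_ *: _)) -scalemxAr.
rewrite (addrAC _ _ (- b)); congr (_ *: _); field.
by rewrite !(denom_neq0 _ k1).
Qed.

Lemma eta_residual k : (1 <= k)%N ->
  A *m x k.+1 - Defs.eta A b alpha x k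
  = ((alpha - 1) / (k%:R + alpha - 2)) *: (A *m z k.+1 - b).
Proof.
move=> k1; rewrite /z leadingS (mulmxDr A _ (_ *: _)) -scalemxAr mulmxBr /Defs.eta.
apply/matrixP => i j; rewrite !mxE; field.
by rewrite !(denom_neq0 _ k1).
Qed.

(** By [eta_residual], the penalty has gradient [A^T (mu k.+1 - mu k)]; added to [A^T mu k], which
    comes from [lambda_hat], it leaves [A^T mu k.+1]. *)
Lemma iterate_subdiff k : (1 <= k)%N ->
  subdiff f (x k.+1)
    (- (((alpha - 1) / (s * k%:R)) *: (M k *m (z k.+1 - z k))
        + gradient g (extrapolate alpha x k) + A^T *m mu k.+1 - eps k)).
Proof.
move=> k1; have [_ Mpos /(_ _ k1) xmin _] := alg.
have := subproblem_subdiff _ _ _ _ _ _ _ _ _ _ _ _ f_convex (Mpos k) xmin.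
rewrite lambda_hatE// eta_residual//; congr (subdiff f _ (- _)).
have -> : mu k.+1 = mu k + (s * k%:R / (alpha - 1)) *: (A *m z k.+1 - b).
  by rewrite -mu_step// addrC subrK.
rewrite /z leading_step//; set w := A *m _ - b; set d := x k.+1 - _.
rewrite (mulmxDr A^T (mu k) (_ *: _)) -!scalemxAr !scalerA.
move: (A^T *m w) (M k *m d) (gradient _ _) (A^T *m mu k) => w' d' p q.
apply/matrixP => i j; rewrite !mxE; field.
by rewrite !(denom_neq0 _ k1).
Qed.

Let lag y := f y + g y - f xs - g xs + dotp ls (A *m y - b).

(** The KKT inclusion says that [xs] minimizes the Lagrangian with multiplier [ls], and
    [A xs = b]. *)
Lemma lag_ge0 y : 0 <= lag y.
Proof.
have [/(_ y)/= ] := KKT_sol; rewrite /lag => h /eqP; rewrite subr_eq0 => /eqP <-.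
by move: h; rewrite -mulmxBr dotp_mulmx dotpNl; lra.
Qed.

Lemma lag_xs : lag xs = 0.
Proof.
have [_ /= ] := KKT_sol; rewrite /lag => ->.
by rewrite -(scale0r 0) dotpZr; ring.
Qed.

(** Adds the subgradient inequality of [f] at [x k.+1], the descent lemma for [g] from the
    extrapolated point to [x k.+1], and the gradient inequality of [g] from the extrapolated point
    to [y]. *)
Lemma lag_step k y : (1 <= k)%N ->
  lag (x k.+1) - lag y <=
  dotp (eps k - ((alpha - 1) / (s * k%:R)) *: (M k *m (z k.+1 - z k))
        - A^T *m (mu k.+1 - ls)) (x k.+1 - y)
  + Lg / 2 * dotp (x k.+1 - extrapolate alpha x k) (x k.+1 - extrapolate alpha x k).
Proof.
move=> k1; have /(_ y) := iterate_subdiff _ k1.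
set xb := extrapolate alpha x k; set d := z k.+1 - z k.
have /(_ (x k.+1 - xb)) := fun d => smooth_taylor_le g xb d Lg g_smooth.
rewrite (addrC xb) subrK ler_norml => /andP[_ gx].
have gy : g xb + dotp (gradient g xb) (y - xb) <= g y.
  apply: (convex_gradient_le _ _ _ _ Lg g_convex) => e.
  have := smooth_taylor_le g xb e Lg g_smooth.
  by rewrite ler_norml => /andP[+ _]; lra.
have -> : lag (x k.+1) - lag y =
  f (x k.+1) + g (x k.+1) - f y - g y + dotp (A^T *m ls) (x k.+1 - y).
  by rewrite /lag -dotp_mulmx mulmxBr !dotp_bilin; ring.
rewrite (mulmxBr A^T).
move: gx gy; rewrite !dotpBr !dotpBl !dotpNl !dotpBl !dotpDl => gx gy fx.
by lra.
Qed.

Let energy k := s * k%:R * (k%:R - 1) / (alpha - 1) ^+ 2 * lag (x k)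
  + 1 / 2 * dotp (z k - xs) (M k.-1 *m (z k - xs))
  + 1 / 2 * dotp (mu k - ls) (mu k - ls).

Lemma energy_step k : (1 <= k)%N ->
  energy k.+1 <=
  energy k + s / (alpha - 1) * (k%:R * dotp (eps k) (z k.+1 - xs)).
Proof.
move=> k1; have [_ Mpos _ _] := alg.
have kge1 := index_ge1 _ k1; have a3 := alpha_ge3; have s0 := s_gt0.
have [[[nk nka] na] ns] := denom_neq0 _ k1.
have zE := leading_step x k k1; have muE := mu_step k k1.
have lag0 := lag_ge0 (x k.+1).
have step1 := lag_step k (x k) k1; have := lag_step k xs k1; rewrite lag_xs subr0.
(* The weights of the two comparison points are chosen so that their displacements combine into
   [z k.+1 - xs]. *)
have zsE : z k.+1 - xs
    = ((k%:R - 1) / (alpha - 1)) *: (x k.+1 - x k) + (x k.+1 - xs).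
  by rewrite /z leadingS -addrA addrCA.
have AzE : A *m (z k.+1 - xs) = A *m z k.+1 - b.
  by have [_ /eqP] := KKT_sol; rewrite subr_eq0 => /eqP/= <-; rewrite mulmxBr.
(* Polarization turns the primal and dual pairings into differences of half squares plus half the
   squared step; the dual one uses the identity matrix. *)
have polM := dotp_polarization (M k) (z k.+1 - xs) (z k - xs) (Mpos k).
have polmu := dotp_polarization 1%:M (mu k.+1 - ls) (mu k - ls)
  (possemidef_scalar 1 ler01).
have dd0 := dotp_ge0 (mu k.+1 - mu k).
have Mle := mx_succeq_dotp _ _ (z k - xs) (Mpos k.-1) (Mpos k) (M_decr _ k1).
have sL0 : 0 <= s * Lg by rewrite mulr_ge0 ?ltW.
have Mge := mx_succeq_dotp _ _ (z k.+1 - z k) (Mpos k)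
  (possemidef_scalar _ sL0) (M_lower _ k1).
have subE d (u v w : 'cV[R]_d) : u - w - (v - w) = u - v.
  by rewrite opprB addrA subrK.
move: Mge polM polmu; rewrite !subE !mul1mx mul_scalar_mx dotpZr.
move: step1 lag0; rewrite /energy -[k.+1%:R]natr1 /=.
set p := eps k - _ - _; set D := dotp (x k.+1 - _) (x k.+1 - _).
set e := (k%:R - 1) / (alpha - 1) => step1 lag0 Mge polM polmu step2.
have DE : dotp (z k.+1 - z k) (z k.+1 - z k)
    = ((k%:R + alpha - 2) / (alpha - 1)) ^+ 2 * D.
  by rewrite zE dotpZl dotpZr mulrA -expr2.
have pE : dotp p (z k.+1 - xs) = dotp (eps k) (z k.+1 - xs)
    - ((alpha - 1) / (s * k%:R)) * (dotp (M k *m (z k.+1 - z k)) (z k.+1 - xs)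
        + dotp (mu k.+1 - mu k) (mu k.+1 - ls)).
  rewrite muE dotpZl (dotpC _ (mu k.+1 - ls)) -AzE dotp_mulmx.
  rewrite /p (dotpBl _ _ (z k.+1 - xs)) (dotpBl _ _ (z k.+1 - xs)) dotpZl.
  by field; rewrite nk na ns.
have pE' : e * dotp p (x k.+1 - x k) + dotp p (x k.+1 - xs)
  = dotp p (z k.+1 - xs) by rewrite zsE (dotpDr p (_ *: _)) dotpZr.
move: pE'; rewrite pE polM polmu.
exact: (energy_step_scalar kge1 a3 s0 (ltW Lg_gt0) lag0 (dotp_ge0 _) DE Mge Mle
  dd0 step1 step2).
Qed.

(** * Summing the errors and bounding the energy by [C] *)

Hypothesis eps_sum : (weighted_error_sum eps < +oo)%E.

Let S := fine (weighted_error_sum eps).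

Lemma error_partial_sum_le k : \sum_(1 <= j < k) j%:R * norm2 (eps j) <= S.
Proof.
have eps0 j : (0 <= (j%:R * norm2 (eps j))%:E)%E.
  by rewrite lee_fin mulr_ge0 ?norm2_ge0.
have sum_le : ((\sum_(1 <= j < k) j%:R * norm2 (eps j))%:E
               <= weighted_error_sum eps)%E.
  rewrite /weighted_error_sum -sumEFin.
  by apply: nneseries_lim_ge => j _ _; exact: eps0.
(* Finiteness of the series makes [fine] return its actual value and not the default 0. *)
rewrite -lee_fin fineK// ge0_fin_numE//.
by apply: nneseries_ge0 => j _ _; exact: eps0.
Qed.

Let E1 := 1 / 2 * normM (M 0%N) (x 1%N - xs) ^+ 2
          + 1 / 2 * norm2 (lam 1%N - ls) ^+ 2.
Let C := E1 + s / (alpha - 1)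
  * (Num.sqrt (2 * E1 / (s * Lg)) + 2 / ((alpha - 1) * Lg) * S) * S.

(** At [k = 1] the factor [k - 1] removes the [lag] term, and [x 1 = x 0], [lam 1 = lam 0] remove
    the extrapolation. *)
Lemma energy1 : energy 1 = E1.
Proof.
have [[x10 lam10 _] Mpos _ _] := alg.
rewrite /energy /z /mu /leading /= x10 lam10 !subrr !scaler0 !addr0 -x10 -lam10.
by rewrite /E1 sqr_normM// sqr_norm2; ring.
Qed.

Lemma energy_sum k : (1 <= k)%N -> energy k <= E1 + s / (alpha - 1)
  * \sum_(1 <= j < k) j%:R * dotp (eps j) (z j.+1 - xs).
Proof.
elim: k => // -[_ _|k IH _]; first by rewrite energy1 big_geq// mulr0 addr0.
rewrite big_nat_recr//= mulrDr addrA.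
by apply: le_trans (energy_step _ _) _ => //; rewrite lerD2r IH.
Qed.

Lemma dist_le_energy k : (1 <= k)%N ->
  s * Lg / 2 * norm2 (z k.+1 - xs) ^+ 2 <= energy k.+1.
Proof.
move=> k1; have [_ Mpos _ _] := alg; have sL0 : 0 <= s * Lg by rewrite mulr_ge0 ?ltW.
have := mx_succeq_dotp _ _ (z k.+1 - xs) (Mpos k)
  (possemidef_scalar _ sL0) (M_lower _ k1).
rewrite mul_scalar_mx dotpZr sqr_norm2 /energy /=.
have m0 := dotp_ge0 (mu k.+1 - ls).
have : 0 <= s * k.+1%:R * (k.+1%:R - 1) / (alpha - 1) ^+ 2 * lag (x k.+1).
  by rewrite mulr_ge0 ?lag_ge0// divr_ge0 ?sqr_ge0// !mulr_ge0 ?(ltW s_gt0)//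
    subr_ge0 ler1n.
move: m0; move: (dotp _ _) (_ * lag _) (dotp _ _) (dotp _ _) => p q r t.
by lra.
Qed.

Lemma E1_ge0 : 0 <= E1.
Proof. by rewrite addr_ge0// mulr_ge0 ?sqr_ge0// divr_ge0. Qed.

Lemma S_ge0 : 0 <= S.
Proof. by have := error_partial_sum_le 0; rewrite big_geq. Qed.

(** Cauchy-Schwarz in [energy_sum], with [dist_le_energy] divided by [s Lg / 2], gives the Bihari
    recursion with [c^2 = 2 E1 / (s Lg)] and [d = 2 / ((alpha - 1) Lg)]. *)
Lemma dist_bound k : (1 <= k)%N ->
  norm2 (z k.+1 - xs)
    <= Num.sqrt (2 * E1 / (s * Lg)) + 2 / ((alpha - 1) * Lg) * S.
Proof.
move: k; have a1 := alpha1_gt0; have sL := mulr_gt0 s_gt0 Lg_gt0.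
apply: (discrete_bihari (fun k => norm2 (z k - xs)) (fun j => j%:R * norm2 (eps j))).
- by move=> k; exact: norm2_ge0.
- by move=> k; rewrite mulr_ge0 ?norm2_ge0.
- exact: sqrtr_ge0.
- by rewrite divr_ge0// mulr_ge0 ?ltW.
- exact: error_partial_sum_le.
move=> k k1.
have -> : Num.sqrt (2 * E1 / (s * Lg)) ^+ 2 = 2 * E1 / (s * Lg).
  by rewrite sqr_sqrtr// divr_ge0 ?(ltW sL)// mulr_ge0// E1_ge0.
have := le_trans (dist_le_energy _ k1) (energy_sum k.+1 isT).
set X := \sum_(_ <= _ < _) _; set Y := \sum_(_ <= _ < _) _ => h.
have XY : X <= Y.
  apply: ler_sum => j _; rewrite -mulrA ler_wpM2l//.
  exact: dotp_le_norm2.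
rewrite -(ler_pM2l (divr_gt0 sL (ltr0n R 2))).
apply: (le_trans h); rewrite mulrDr.
have -> : s * Lg / 2 * (2 * E1 / (s * Lg)) = E1.
  by field; rewrite !gt_eqF// s_gt0.
have -> : s * Lg / 2 * (2 / ((alpha - 1) * Lg) * Y) = s / (alpha - 1) * Y.
  by field; rewrite !gt_eqF.
by rewrite lerD2l ler_wpM2l// divr_ge0 ?ltW.
Qed.

Lemma energy_le k : (1 <= k)%N -> energy k <= C.
Proof.
move=> k1; apply: (le_trans (energy_sum _ k1)).
rewrite /C lerD2l -[leRHS]mulrA.
apply: ler_wpM2l; first by rewrite divr_ge0 ?ltW ?alpha1_gt0.
(* [B] is the uniform bound of [dist_bound], so the error pairings sum to at most [B S]. *)
set B := Num.sqrt _ + _.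
have B0 : 0 <= B.
  rewrite addr_ge0 ?sqrtr_ge0// mulr_ge0 ?S_ge0// divr_ge0// mulr_ge0// ltW//.
  exact: alpha1_gt0.
apply: (@le_trans _ _ (B * \sum_(1 <= j < k) j%:R * norm2 (eps j))); last first.
  by rewrite ler_wpM2l// error_partial_sum_le.
rewrite mulr_sumr big_nat [leRHS]big_nat; apply: ler_sum => j /andP[j1 _].
rewrite mulrCA ler_wpM2l// (le_trans (dotp_le_norm2 _ _))// mulrC.
by rewrite ler_wpM2r ?norm2_ge0// dist_bound.
Qed.

(** * Rates for the feasibility and the objective *)

Let scaled k : 'cV[R]_m :=
  ((k%:R - 1) * (k%:R + alpha - 3)) *: (A *m x k - b).

Lemma mu_dist k : (1 <= k)%N -> norm2 (mu k - ls) <= Num.sqrt (2 * C).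
Proof.
move=> k1; have [_ Mpos _ _] := alg; have := energy_le _ k1.
rewrite /energy => le_C; rewrite /norm2 ler_wsqrtr//.
have [_ /(_ (z k - xs))] := Mpos k.-1.
have : 0 <= s * k%:R * (k%:R - 1) / (alpha - 1) ^+ 2 * lag (x k).
  rewrite mulr_ge0 ?lag_ge0// divr_ge0 ?sqr_ge0// !mulr_ge0 ?(ltW s_gt0)//.
  by rewrite subr_ge0 index_ge1.
move: le_C; move: (dotp _ _) (_ * lag _) (dotp _ _) => p q r.
by lra.
Qed.

Lemma lag_le k : (1 < k)%N ->
  lag (x k) <= (alpha - 1) ^+ 2 * C / (s * (k%:R ^+ 2 - k%:R)).
Proof.
move=> k1; have [_ Mpos _ _] := alg; have := energy_le _ (ltnW k1).
have := dotp_ge0 (mu k - ls); have [_ /(_ (z k - xs))] := Mpos k.-1.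
rewrite /energy; move: (dotp (z k - xs) _) (dotp (mu k - _) _) => p q p0 q0 le_C.
have k1R : 1 < k%:R :> R by rewrite ltr1n.
have -> : k%:R ^+ 2 - k%:R = k%:R * (k%:R - 1) :> R by ring.
have a2 : 0 < (alpha - 1) ^+ 2 by rewrite exprn_gt0 ?alpha1_gt0.
have k0 : 0 < s * (k%:R * (k%:R - 1)).
  by rewrite !mulr_gt0 ?s_gt0 ?subr_gt0// (lt_trans ltr01).
have {le_C} : s * k%:R * (k%:R - 1) / (alpha - 1) ^+ 2 * lag (x k) <= C.
  by move: le_C; move: (_ * lag _) => r; lra.
rewrite -(ler_pM2l (divr_gt0 a2 k0)) [leRHS]mulrAC; apply: le_trans.
rewrite le_eqVlt; apply/orP; left; apply/eqP; field.
by rewrite !(denom_neq0 _ (ltnW k1)) gt_eqF ?subr_gt0.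
Qed.

(** Both sides equal [k (k + alpha - 2) (A x_(k+1) - b)]: the weight in [scaled] is chosen so that
    the [A x_k] terms cancel. *)
Lemma scaled_step k : (1 <= k)%N ->
  scaled k.+1 = (k%:R / (k%:R + alpha - 3)) *: scaled k
    + ((alpha - 1) ^+ 2 / s) *: (mu k.+1 - mu k).
Proof.
move=> k1; rewrite mu_step// /z leadingS /scaled.
rewrite (mulmxDr A _ (_ *: _)) -scalemxAr mulmxBr.
move: (A *m x k.+1) (A *m x k) => u v.
apply/matrixP => i j; rewrite !mxE -[k.+1%:R]natr1; field.
have k1R := index_ge1 _ k1; have a3 := alpha_ge3.
by rewrite !(denom_neq0 _ k1) gt_eqF//; lra.
Qed.

Lemma scaled_sub_le k : (1 <= k)%N ->
  norm2 (scaled k - ((alpha - 1) ^+ 2 / s) *: (mu k - ls))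
    <= (alpha - 1) ^+ 2 / s * Num.sqrt (2 * C).
Proof.
have c0 : 0 <= (alpha - 1) ^+ 2 / s by rewrite divr_ge0 ?sqr_ge0 ?ltW.
elim: k => // -[_ _|k IH _].
  rewrite /scaled subrr mul0r scale0r sub0r norm2N norm2Z ger0_norm//.
  by rewrite ler_wpM2l// mu_dist.
set t := k.+1%:R / (k.+1%:R + alpha - 3).
have k1 := index_ge1 k.+1 isT; have a3 := alpha_ge3.
have t0 : 0 <= t by rewrite divr_ge0//; lra.
(* [alpha >= 3] makes [t] at most 1, hence the next line a convex combination. *)
have t1 : 0 <= 1 - t by rewrite subr_ge0 ler_pdivrMr; lra.
rewrite scaled_step// -/t.
rewrite (_ : _ - _ = t *: (scaled k.+1 - ((alpha - 1) ^+ 2 / s) *: (mu k.+1 - ls))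
  - ((1 - t) * ((alpha - 1) ^+ 2 / s)) *: (mu k.+1 - ls)); last first.
  move: (mu k.+2) (mu k.+1) (scaled k.+1) => u v w.
  by apply/matrixP => i j; rewrite !mxE; ring.
apply: (le_trans (norm2D _ _)).
rewrite norm2N !norm2Z (ger0_norm t0) (ger0_norm (mulr_ge0 t1 c0)).
have := ler_wpM2l t0 (IH isT).
have := ler_wpM2l (mulr_ge0 t1 c0) (mu_dist k.+1 isT).
by lra.
Qed.

Lemma feasibility_le k : (1 < k)%N ->
  norm2 (A *m x k - b) <= 4 * (alpha - 1) ^+ 2 * Num.sqrt (2 * C)
         / (s * (k%:R - 1) * (k%:R + alpha - 3)).
Proof.
move=> k1; have k1R : 1 < k%:R :> R by rewrite ltr1n.
have a3 := alpha_ge3.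
have c0 : 0 <= (alpha - 1) ^+ 2 / s by rewrite divr_ge0 ?sqr_ge0 ?ltW.
have d0 : 0 < (k%:R - 1) * (k%:R + alpha - 3) by rewrite mulr_gt0; lra.
rewrite ler_pdivlMr -mulrA ?(mulr_gt0 s_gt0)//.
(* The triangle inequality gives the factor 2, which is within the stated 4. *)
have : norm2 (scaled k) <= 2 * ((alpha - 1) ^+ 2 / s * Num.sqrt (2 * C)).
  rewrite -[scaled k](subrK (((alpha - 1) ^+ 2 / s) *: (mu k - ls))).
  apply: (le_trans (norm2D _ _)); rewrite mulr2n mulrDl mul1r.
  rewrite lerD ?scaled_sub_le ?(ltnW k1)//.
  by rewrite norm2Z ger0_norm// ler_wpM2l// mu_dist// ltnW.
rewrite /scaled norm2Z gtr0_norm// => h.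
have := ler_wpM2l (ltW s_gt0) h.
rewrite [X in _ <= X](_ : _ = 2 * ((alpha - 1) ^+ 2 * Num.sqrt (2 * C))); last first.
  by field; rewrite gt_eqF.
have : 0 <= (alpha - 1) ^+ 2 * Num.sqrt (2 * C).
  by rewrite mulr_ge0 ?sqr_ge0 ?sqrtr_ge0.
by lra.
Qed.

(** The objective gap is [lag (x k)] minus the pairing of [ls] with the residual; each part has its
    own rate. *)
Lemma objective_le k : (1 < k)%N ->
  `|f (x k) + g (x k) - f xs - g xs|
    <= (alpha - 1) ^+ 2 * C / (s * (k%:R ^+ 2 - k%:R))
       + 4 * (alpha - 1) ^+ 2 * Num.sqrt (2 * C) * norm2 ls
         / (s * (k%:R - 1) * (k%:R + alpha - 3)).
Proof.
move=> k1; rewrite (_ : f _ + _ - _ - _ = lag (x k) - dotp ls (A *m x k - b)).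
  apply: (le_trans (ler_normB _ _)); apply: lerD.
    by rewrite ger0_norm ?lag_ge0// lag_le.
  apply: (le_trans (normr_dotp_le_norm2 _ _)).
  rewrite mulrC mulrAC ler_wpM2r ?norm2_ge0//.
  exact: feasibility_le.
by rewrite /lag addrK.
Qed.

End Iteration.

Theorem theorem2 (R : realType) (m n : nat)
    (A : 'M[R]_(m, n)) (b : 'cV[R]_m) (f g : 'cV[R]_n -> R)
    (Lg s alpha : R)
    (xs : 'cV[R]_n) (ls : 'cV[R]_m)
    (x : nat -> 'cV[R]_n) (lam : nat -> 'cV[R]_m)
    (M : nat -> 'M[R]_n) (eps : nat -> 'cV[R]_n)
    (f_closed : closed_function f)
    (f_convex : convex_function [set: 'cV[R]_n] f)
    (g_convex : convex_function [set: 'cV[R]_n] g)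
    (Lg_gt0 : 0 < Lg)
    (g_smooth : smooth_with Lg g)
    (KKT_sol : KKT (fun z => f z + g z) A b (xs, ls))
    (s_gt0 : 0 < s) (alpha_ge3 : 3 <= alpha)
    (alg : generated_by_algorithm A b f g s alpha x lam M eps)
    (M_decr : forall k, (1 <= k)%N -> mx_succeq (M k.-1) (M k))
    (M_lower : forall k, (1 <= k)%N -> mx_succeq (M k) ((s * Lg)%:M))
    (eps_sum : (weighted_error_sum eps < +oo)%E) :
  let E1 := 1 / 2 * normM (M 0%N) (x 1%N - xs) ^+ 2
            + 1 / 2 * norm2 (lam 1%N - ls) ^+ 2 in
  let S := fine (weighted_error_sum eps) in
  let C := 1 / 2 * normM (M 0%N) (x 1%N - xs) ^+ 2
           + 1 / 2 * norm2 (lam 1%N - ls) ^+ 2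
           + s / (alpha - 1)
             * (Num.sqrt (2 * E1 / (s * Lg)) + 2 / ((alpha - 1) * Lg) * S)
             * S in
  forall k, (1 < k)%N ->
    norm2 (A *m x k - b)
      <= 4 * (alpha - 1) ^+ 2 * Num.sqrt (2 * C)
         / (s * (k%:R - 1) * (k%:R + alpha - 3))
    /\
    `|f (x k) + g (x k) - f xs - g xs|
      <= (alpha - 1) ^+ 2 * C / (s * (k%:R ^+ 2 - k%:R))
         + 4 * (alpha - 1) ^+ 2 * Num.sqrt (2 * C) * norm2 ls
           / (s * (k%:R - 1) * (k%:R + alpha - 3)).
Proof.
move=> E1 S C k k1; split.
- exact: (feasibility_le A b f g Lg s alpha xs ls x lam M eps).
- exact: (objective_le A b f g Lg s alpha xs ls x lam M eps).
Qed.
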